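(* If a finitely generated discrete group satisfies Chu duality, then it is virtually abelian. In particular, the free group on two generators (with the discrete topology) does not satisfy Chu duality.
   Context: Let $U(n)$ be the group of unitary $n\times n$ complex matrices with its usual topology, and let $U:=\coprod_{n\geq 1}U(n)$ be the topological disjoint union, equipped with the direct sum $\oplus\colon U(n)\times U(m)\to U(n+m)$ and tensor product $\otimes\colon U(n)\times U(m)\to U(nm)$ of matrices. Let $G$ be a locally compact group. For $n\ge 1$ set $G^x_n:=\{\phi\colon G\to U(n)\mid \phi\text{ a continuous homomorphism}\}$, endowed with the compact-open topology, and let $G^x:=\coprod_{n\geq 1}G^x_n$ (topological disjoint union). The operations on $U$ induce, pointwise, operations $\oplus\colon G^x_n\times G^x_m\to G^x_{n+m}$ and $\otimes\colon G^x_n\times G^x_m\to G^x_{nm}$. For $\phi\in G^x_n$ and $u\in U(n)$, $u\phi u^*\in G^x_n$ denotes $g\mapsto u\phi(g)u^*$. The Chu dual $G^{xx}$ is the set of continuous degree-preserving maps $\mu\colon G^x\to U$ (i.e. $\mu(G^x_n)\subset U(n)$ for all $n$) such that $\mu(\phi\oplus\phi')=\mu(\phi)\oplus\mu(\phi')$ and $\mu(\phi\otimes\phi')=\mu(\phi)\otimes\mu(\phi')$ for all $\phi,\phi'\in G^x$, and $\mu(u\phi u^* )=u\mu(\phi)u^*$ for all $\phi\in G^x$ and $u\in U$ of the same degree. $G^{xx}$ is endowed with the compact-open topology and with pointwise multiplication, making it a topological group. The evaluation map $\mathrm{ev}\colon G\to G^{xx}$, $g\mapsto(\phi\mapsto\phi(g))$,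 is a continuous homomorphism. The group $G$ satisfies Chu duality if and only if $\mathrm{ev}\colon G\to G^{xx}$ is a homeomorphism. A group is virtually abelian if it has an abelian subgroup of finite index. *)

(* Defs.v *)
From HB Require Import structures.
From mathcomp Require Import all_boot all_order all_algebra complex mxtens.
From mathcomp Require Import all_classical reals topology normedtype.

Set Implicit Arguments.
Unset Strict Implicit.
Unset Printing Implicit Defensive.

Import Order.TTheory GRing.Theory Num.Theory.
Import numFieldNormedType.Exports.

Local Open Scope classical_set_scope.
Local Open Scope group_scope.

HB.mixin Record isTopologicalGroup G & Group G & Topological G := {
  mulg_continuous : continuous (fun xy : G * G => xy.1 * xy.2);
  invg_continuous : continuous (fun x : G => x^-1)
}.

#[short(type="topGroupType")]
HB.structure Definition TopologicalGroup :=
  {G of Group G & Topological G & isTopologicalGroup G}.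

Section DiscreteGroup.
Variable G : groupType.

HB.instance Definition _ := Group.copy (discrete_topology G) G.

Let discrete_mulg_continuous : continuous
  (fun xy : discrete_topology G * discrete_topology G => xy.1 * xy.2).
Proof.
move=> [x y] A /= /nbhs_singleton Axy.
exists ([set x], [set y]); first by split; exact: discrete_set1.
by move=> [_ _] /= [-> ->].
Qed.

Let discrete_invg_continuous : continuous (fun x : discrete_topology G => x^-1).
Proof.
move=> x A /nbhs_singleton Ax.
by apply: (filterS _ (@discrete_set1 (discrete_topology G) x)) => _ ->.
Qed.

HB.instance Definition _ := isTopologicalGroup.Build (discrete_topology G)
  discrete_mulg_continuous discrete_invg_continuous.

End DiscreteGroup.

Definition finitely_generated (G : groupType) : Prop :=
  exists s : seq G, forall H : {pred G},
    group_closed H -> {subset s <= H} -> forall x, x \in H.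

Definition virtually_abelian (G : groupType) : Prop :=
  exists H : {pred G},
    [/\ group_closed H,
        {in H &, forall x y, commute x y} &
        finite_set [set [set x * h | h in [set` H]] | x in [set: G]]].

(* The topology on [R[i]] is inferred from the [numClosedFieldType] structure,
   hence this constant rather than the bare [R[i]]. *)
Definition cplx (R : realType) : numClosedFieldType := R[i].

Definition unitary (R : realType) (n : nat) : Type :=
  set_type [set A : 'M[cplx R]_n | A \is unitarymx].

HB.instance Definition _ (R : realType) (n : nat) :=
  Topological.copy (unitary R n)
    (set_type [set A : 'M[cplx R]_n | A \is unitarymx]).

Section Initial.
Context {T V : topologicalType} (A : set V).

Lemma continuous_set_type (f : T -> set_type A) :
  continuous (fun t => set_val (f t)) -> continuous f.
Proof.
move=> cf; apply/continuousP => _ [O oO <-].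
by rewrite -comp_preimage; move/continuousP: cf; apply.
Qed.

End Initial.

Section Unitary.
Variable R : realType.
Local Notation C := (cplx R).
Local Open Scope ring_scope.

Definition umx n (u : unitary R n) : 'M[C]_n := set_val u.

Lemma umx_unitary n (u : unitary R n) : umx u \is unitarymx.
Proof. by case: u => A hA; exact: set_mem hA. Qed.

Definition Unitary n (A : 'M[C]_n) (hA : A \is unitarymx) : unitary R n :=
  exist _ A (mem_set hA).

Lemma umx_Unitary n (A : 'M[C]_n) (hA : A \is unitarymx) : umx (Unitary hA) = A.
Proof. by rewrite /umx set_valE. Qed.

Lemma umx_inj n : injective (@umx n).
Proof. exact: val_inj. Qed.

Lemma umx_continuous n : continuous (@umx n).
Proof. exact: initial_continuous. Qed.

Lemma unitary_continuous (T : topologicalType) n (f : T -> unitary R n) :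
  continuous (fun t => umx (f t)) -> continuous f.
Proof. exact: continuous_set_type. Qed.

Lemma mx_continuous (T : topologicalType) m n (f : T -> 'M[C]_(m, n)) :
  (forall i j, continuous (fun t => f t i j)) -> continuous f.
Proof.
move=> cf t A [P Pt sPA].
have nP : \forall s \near t, forall i j, P i j (f s i j).
  apply: filter_forall => i; apply: filter_forall => j.
  exact: (cf i j t _ (Pt i j)).
by apply: (filterS _ nP) => s Ps; exact: sPA.
Qed.

Lemma mx_coord_continuous m n i j :
  continuous (fun A : 'M[C]_(m, n) => A i j).
Proof.
move=> A B nB.
exists (fun i' j' => [set x | i' = i -> j' = j -> B x]).
  move=> i' j'; case: (pselect (i' = i /\ j' = j)) => [[-> ->]|h].
    have {}nB : nbhs (A i j) B := nB.
    by apply: (@filterS _ _ _ B) => // x Bx _ _.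
  by apply: (@filterS _ _ _ setT); [move=> x _ /= ? ?; case: h|exact: filterT].
by move=> N /= /(_ i j); apply.
Qed.

Lemma umx_coord_continuous (T : topologicalType) n (f : T -> unitary R n) i j :
  continuous f -> continuous (fun t => umx (f t) i j).
Proof.
move=> cf t.
apply: (@continuous_comp _ _ _ (fun t => umx (f t)) (fun A : 'M[C]_n => A i j)).
  by apply: (@continuous_comp _ _ _ f (@umx n)); [exact: cf
    | exact: umx_continuous].
exact: mx_coord_continuous.
Qed.

Fact unitary_one_subproof n : (1%:M : 'M[C]_n) \is unitarymx.
Proof. by apply/unitarymxP; rewrite trmx1 map_mx1 mulmx1. Qed.

Definition unitary_one n : unitary R n := Unitary (unitary_one_subproof n).
Definition unitary_mul n (u v : unitary R n) : unitary R n :=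
  Unitary (mul_unitarymx (umx_unitary u) (umx_unitary v)).

Lemma umxM n (u v : unitary R n) : umx (unitary_mul u v) = umx u *m umx v.
Proof. exact: umx_Unitary. Qed.

Fact unitary_inv_subproof n (u : unitary R n) : ((umx u)^t*)%sesqui \is unitarymx.
Proof. by rewrite trmxC_unitary umx_unitary. Qed.

Definition unitary_inv n (u : unitary R n) : unitary R n :=
  Unitary (unitary_inv_subproof u).

Fact unitary_mulA n : associative (@unitary_mul n).
Proof. by move=> u v w; apply: umx_inj; rewrite !umxM mulmxA. Qed.
Fact unitary_mul1 n : left_id (unitary_one n) (@unitary_mul n).
Proof. by move=> u; apply: umx_inj; rewrite umxM umx_Unitary mul1mx. Qed.
Fact unitary_1mul n : right_id (unitary_one n) (@unitary_mul n).
Proof. by move=> u; apply: umx_inj; rewrite umxM umx_Unitary mulmx1. Qed.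
Fact unitary_mulV n :
  right_inverse (unitary_one n) (@unitary_inv n) (@unitary_mul n).
Proof.
move=> u; apply: umx_inj; rewrite umxM !umx_Unitary; apply/unitarymxP.
exact: umx_unitary.
Qed.
Fact unitary_Vmul n :
  left_inverse (unitary_one n) (@unitary_inv n) (@unitary_mul n).
Proof.
move=> u; apply: umx_inj; rewrite umxM !umx_Unitary; apply: mulmx1C.
by apply/unitarymxP; exact: umx_unitary.
Qed.

HB.instance Definition _ n := isGroup.Build (unitary R n)
  (@unitary_mulA n) (@unitary_mul1 n) (@unitary_1mul n)
  (@unitary_Vmul n) (@unitary_mulV n).

Fact dsum_subproof n m (u : unitary R n) (v : unitary R m) :
  block_mx (umx u) 0 0 (umx v) \is unitarymx.
Proof.
apply/unitarymxP; rewrite tr_block_mx map_block_mx mulmx_block.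
rewrite !trmx0 !map_mx0 !mulmx0 !mul0mx !addr0 !add0r.
by rewrite !(unitarymxP (umx_unitary _)) -scalar_mx_block.
Qed.

Definition dsum n m (u : unitary R n) (v : unitary R m) : unitary R (n + m) :=
  Unitary (dsum_subproof u v).

Fact tens_subproof n m (u : unitary R n) (v : unitary R m) :
  tensmx (umx u) (umx v) \is unitarymx.
Proof.
apply/unitarymxP; rewrite trmx_tens map_mxT tensmx_mul.
rewrite !(unitarymxP (umx_unitary _)).
apply/matrixP => i j; case: (mxtens_indexP i) => i0 i1.
case: (mxtens_indexP j) => j0 j1; rewrite tensmxE !mxE.
by rewrite (can_eq (@mxtens_indexK n m)) xpair_eqE -mulnb natrM.
Qed.

Definition tens n m (u : unitary R n) (v : unitary R m) : unitary R (n * m) :=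
  Unitary (tens_subproof u v).

Lemma dsum_continuous (T : topologicalType) n m
    (f : T -> unitary R n) (g : T -> unitary R m) :
  continuous f -> continuous g -> continuous (fun t => dsum (f t) (g t)).
Proof.
move=> cf cg; apply: unitary_continuous; apply: mx_continuous => i j.
have eqC (h k : T -> C) : continuous h -> h =1 k -> continuous k.
  by move=> ch /funext <-.
rewrite -(fintype.splitK i) -(fintype.splitK j).
case: (fintype.split i) => i'; case: (fintype.split j) => j'.
- apply: (eqC (fun t => umx (f t) i' j')) => [|t].
    exact: (umx_coord_continuous cf).
  by rewrite umx_Unitary block_mxEul.
- apply: (eqC (fun=> 0)) => [t|t]; first exact: cvg_cst.
  by rewrite umx_Unitary block_mxEur mxE.
- apply: (eqC (fun=> 0)) => [t|t]; first exact: cvg_cst.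
  by rewrite umx_Unitary block_mxEdl mxE.
- apply: (eqC (fun t => umx (g t) i' j')) => [|t].
    exact: (umx_coord_continuous cg).
  by rewrite umx_Unitary block_mxEdr.
Qed.

Lemma tens_continuous (T : topologicalType) n m
    (f : T -> unitary R n) (g : T -> unitary R m) :
  continuous f -> continuous g -> continuous (fun t => tens (f t) (g t)).
Proof.
move=> cf cg; apply: unitary_continuous; apply: mx_continuous => i j t.
under eq_fun do rewrite umx_Unitary mxE.
apply: cvgM.
- exact: (umx_coord_continuous cf).
- exact: (umx_coord_continuous cg).
Qed.

Lemma unitary_mul_continuous (T : topologicalType) n (f g : T -> unitary R n) :
  continuous f -> continuous g -> continuous (fun t => (f t * g t)%g).
Proof.
move=> cf cg; apply: unitary_continuous; apply: mx_continuous => i j.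
have -> : (fun t => umx (f t * g t)%g i j) =
    (fun t => \sum_k umx (f t) i k * umx (g t) k j).
  by apply/funext => t; rewrite umxM mxE.
apply: (@continuous_big _ _ +%R 0 predT) => [z|k _ t].
  by apply: cvgD; [exact: cvg_fst|exact: cvg_snd].
apply: cvgM.
- exact: (umx_coord_continuous cf).
- exact: (umx_coord_continuous cg).
Qed.

Lemma dsumM n m (u u' : unitary R n) (v v' : unitary R m) :
  dsum (u * u')%g (v * v')%g = (dsum u v * dsum u' v')%g.
Proof.
apply: umx_inj; rewrite !(umxM, umx_Unitary) mulmx_block.
by rewrite !mulmx0 !mul0mx !addr0 !add0r.
Qed.

Lemma tensM n m (u u' : unitary R n) (v v' : unitary R m) :
  tens (u * u')%g (v * v')%g = (tens u v * tens u' v')%g.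
Proof. by apply: umx_inj; rewrite !(umxM, umx_Unitary) tensmx_mul. Qed.

End Unitary.

Definition degree : Type := {n : nat | (0 < n)%N}.
HB.instance Definition _ := Choice.on degree.
Coercion degree_val (d : degree) : nat := val d.

Definition degree_add (d e : degree) : degree :=
  exist _ (d + e)%N (ltn_addr e (valP d)).

Fact degree_mul_subproof (d e : degree) : (0 < d * e)%N.
Proof. by rewrite muln_gt0 !(valP _). Qed.

Definition degree_mul (d e : degree) : degree :=
  exist _ (d * e)%N (degree_mul_subproof d e).

Definition unitaries (R : realType) : Type := {d : degree & unitary R d}.
HB.instance Definition _ (R : realType) := Topological.copy (unitaries R)
  {d : degree & (unitary R d : topologicalType)}.

Definition unitaries_dsum (R : realType) (x y : unitaries R) : unitaries R :=
  existT _ (degree_add (projT1 x) (projT1 y)) (dsum (projT2 x) (projT2 y)).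
Definition unitaries_tens (R : realType) (x y : unitaries R) : unitaries R :=
  existT _ (degree_mul (projT1 x) (projT1 y)) (tens (projT2 x) (projT2 y)).

Section ChuDual.
Variables (R : realType) (G : topGroupType).

Definition is_rep n (phi : {compact-open, G -> unitary R n}) : Prop :=
  continuous (phi : G -> unitary R n) /\ {morph phi : x y / x * y}.

Definition rep n : Type := set_type [set phi | @is_rep n phi].
HB.instance Definition _ n :=
  Topological.copy (rep n) (set_type [set phi | @is_rep n phi]).

Definition rep_fun n (phi : rep n) : G -> unitary R n := set_val phi.
Coercion rep_fun : rep >-> Funclass.

Definition Rep n (phi : G -> unitary R n) (h : is_rep phi) : rep n :=
  exist _ (phi : {compact-open, G -> unitary R n}) (mem_set h).

Lemma rep_continuous n (phi : rep n) : continuous phi.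
Proof. by case: phi => f hf; have [] := set_mem hf. Qed.

Lemma repM n (phi : rep n) : {morph phi : x y / x * y}.
Proof. by case: phi => f hf; have [] := set_mem hf. Qed.

Fact rep_dsum_subproof n m (phi : rep n) (psi : rep m) :
  is_rep (fun g => dsum (phi g) (psi g)).
Proof.
split; first by apply: dsum_continuous; exact: rep_continuous.
by move=> x y; rewrite !repM dsumM.
Qed.
Definition rep_dsum n m (phi : rep n) (psi : rep m) : rep (n + m) :=
  Rep (rep_dsum_subproof phi psi).

Fact rep_tens_subproof n m (phi : rep n) (psi : rep m) :
  is_rep (fun g => tens (phi g) (psi g)).
Proof.
split; first by apply: tens_continuous; exact: rep_continuous.
by move=> x y; rewrite !repM tensM.
Qed.
Definition rep_tens n m (phi : rep n) (psi : rep m) : rep (n * m) :=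
  Rep (rep_tens_subproof phi psi).

Fact rep_conj_subproof n (u : unitary R n) (phi : rep n) :
  is_rep (fun g => u * phi g * u^-1).
Proof.
split; last by move=> x y; rewrite repM !mulgA mulgVK.
apply: (unitary_mul_continuous (f := fun g => u * phi g)) => [|g]; last first.
  exact: cvg_cst.
apply: (unitary_mul_continuous (f := fun=> u)) => [g|]; first exact: cvg_cst.
exact: rep_continuous.
Qed.
(* In [unitary R n], the group inverse [u^-1] is the adjoint u^*. *)
Definition rep_conj n (u : unitary R n) (phi : rep n) : rep n :=
  Rep (rep_conj_subproof u phi).

Definition reps : Type := {d : degree & rep d}.
HB.instance Definition _ :=
  Topological.copy reps {d : degree & (rep d : topologicalType)}.

Definition reps_dsum (x y : reps) : reps :=
  existT _ (degree_add (projT1 x) (projT1 y)) (rep_dsum (projT2 x) (projT2 y)).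
Definition reps_tens (x y : reps) : reps :=
  existT _ (degree_mul (projT1 x) (projT1 y)) (rep_tens (projT2 x) (projT2 y)).

(* [reps] is G^x, and [is_quasirep] defines the subset G^xx of the space of all
   maps from G^x to U, so that [chu_dual] carries the compact-open topology.
   Its group structure is not needed to say that [ev] is a homeomorphism. *)
Definition is_quasirep (mu : {compact-open, reps -> unitaries R}) : Prop :=
  [/\ continuous (mu : reps -> unitaries R),
      (forall x, projT1 (mu x) = projT1 x),
      (forall x y, mu (reps_dsum x y) = unitaries_dsum (mu x) (mu y)),
      (forall x y, mu (reps_tens x y) = unitaries_tens (mu x) (mu y)) &
      (* mu (u phi u^* ) = u mu(phi) u^*; [v] is mu(phi) typed in [unitary R d],
         and such a [v] exists since mu preserves degrees *)
      (forall (d : degree) (u v : unitary R d) (phi : rep d),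
         mu (existT _ d phi) = existT _ d v ->
         mu (existT _ d (rep_conj u phi)) = existT _ d (u * v * u^-1))].

Definition chu_dual : Type := set_type [set mu | is_quasirep mu].
HB.instance Definition _ :=
  Topological.copy chu_dual (set_type [set mu | is_quasirep mu]).

Definition evaluation (g : G) : {compact-open, reps -> unitaries R} :=
  fun x => existT _ (projT1 x) (projT2 x g).

Lemma evaluation_continuous (g : G) :
  continuous (evaluation g : reps -> unitaries R).
Proof.
apply/continuousP => O oO; apply/sigT_openP => d'; pose d : degree := d'.
have oOd : open [set v : unitary R d | O (existT _ d v)].
  by move/sigT_openP: oO; apply.
exists [set f : {compact-open, G -> unitary R d} |
          f @` [set g] `<=` [set v | O (existT _ d v)]].
  by apply: compact_open_open => //; exact: compact_set1.
apply/seteqP; split=> phi /=; first by apply; exists g.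
by move=> h _ [_ -> <-].
Qed.

Fact ev_subproof (g : G) : is_quasirep (evaluation g).
Proof.
split=> //; first exact: evaluation_continuous.
by move=> d u v phi h; rewrite -(existT_inj2 h).
Qed.

Definition ev (g : G) : chu_dual :=
  exist _ (evaluation g) (mem_set (ev_subproof g)).

(* Meant for locally compact [G]; discrete groups are. *)
Definition chu_duality : Prop :=
  continuous ev /\
  exists2 inv : chu_dual -> G, continuous inv & cancel ev inv /\ cancel inv ev.

End ChuDual.

(* Elements of the free group on [X] are the reduced words in the letters
   [(x, true)], standing for x, and [(x, false)], standing for x^-1. *)
Section FreeGroup.
Variable X : choiceType.
Local Notation letter := (X * bool)%type.
Implicit Types (l : letter) (u v w : seq letter).

Definition letter_inv l : letter := (l.1, ~~ l.2).

Definition reduced w : bool := sorted (fun l l' => l' != letter_inv l) w.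

Definition free_group : Type := {w : seq letter | reduced w}.
HB.instance Definition _ := Choice.on free_group.

Definition word_cons l w : seq letter :=
  if w is l' :: w' then if l' == letter_inv l then w' else l :: w else [:: l].

Lemma letter_invK : involutive letter_inv.
Proof. by case=> x b; rewrite /letter_inv /= negbK. Qed.

Lemma reduced_behead l w : reduced (l :: w) -> reduced w.
Proof. exact: path_sorted. Qed.

Lemma word_cons_reduced l w : reduced w -> reduced (word_cons l w).
Proof.
case: w => // l' w rw /=; case: ifPn => [_|ne]; first exact: reduced_behead rw.
by rewrite /reduced /= ne.
Qed.

Lemma word_consV l w : reduced w -> word_cons l (word_cons (letter_inv l) w) = w.
Proof.
case: w => [|l' w] rw; first by rewrite /= eqxx.
rewrite /= letter_invK; have [el|_] := eqVneq l' l; last by rewrite /= eqxx.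
case: w rw => [|l'' w] /=; first by rewrite el.
by rewrite el => /andP[/negPf ->].
Qed.

Definition word_mul u v : seq letter := foldr word_cons v u.

Lemma word_mul_reduced u v : reduced v -> reduced (word_mul u v).
Proof. by move=> rv; elim: u => //= l u; exact: word_cons_reduced. Qed.

Lemma word_mul_cons l u v :
  reduced v -> word_mul (word_cons l u) v = word_cons l (word_mul u v).
Proof.
move=> rv; case: u => //= l' u; case: eqP => //= ->.
by rewrite word_consV // word_mul_reduced.
Qed.

Lemma word_mulA u v w :
  reduced w -> word_mul u (word_mul v w) = word_mul (word_mul u v) w.
Proof. by move=> rw; elim: u => //= l u ->; rewrite word_mul_cons. Qed.

Lemma word_mul1 w : reduced w -> word_mul w [::] = w.
Proof.
elim: w => //= l w IHw rw; rewrite IHw ?(reduced_behead rw) //.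
by case: w rw {IHw} => //= l' w /andP[/negPf ->].
Qed.

Definition word_inv w : seq letter := rev (map letter_inv w).

Lemma word_inv_reduced w : reduced w -> reduced (word_inv w).
Proof.
rewrite /reduced /word_inv rev_sorted sorted_map; apply: sub_sorted => l l'.
by apply: contraNN => /eqP/(can_inj letter_invK) ->; rewrite letter_invK.
Qed.

Lemma word_invK : involutive word_inv.
Proof.
by move=> w; rewrite /word_inv map_rev revK mapK //; exact: letter_invK.
Qed.

Lemma word_mulV w v : reduced v -> word_mul w (word_mul (word_inv w) v) = v.
Proof.
elim: w v => //= l w IHw v rv.
rewrite /word_inv map_cons rev_cons /word_mul foldr_rcons -/(word_mul _ _).
by rewrite -/(word_mul _ _) IHw ?word_consV ?word_cons_reduced.
Qed.

Definition free_one : free_group := exist _ [::] isT.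
Definition free_mul (a b : free_group) : free_group :=
  exist _ (word_mul (val a) (val b)) (word_mul_reduced (val a) (valP b)).
Definition free_inv (a : free_group) : free_group :=
  exist _ (word_inv (val a)) (word_inv_reduced (valP a)).

Fact free_mulA : associative free_mul.
Proof. by move=> a b c; apply: val_inj; rewrite /= word_mulA ?(valP c). Qed.
Fact free_mul1g : left_id free_one free_mul.
Proof. by move=> a; apply: val_inj. Qed.
Fact free_mulg1 : right_id free_one free_mul.
Proof. by move=> a; apply: val_inj; rewrite /= word_mul1 ?(valP a). Qed.
Fact free_mulgV : right_inverse free_one free_inv free_mul.
Proof.
move=> a; apply: val_inj => /=.
rewrite -[word_inv _]word_mul1 ?word_inv_reduced ?(valP a) //.
exact: word_mulV.
Qed.
Fact free_mulVg : left_inverse free_one free_inv free_mul.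
Proof.
move=> a; rewrite -[X in free_mul _ X](_ : free_inv (free_inv a) = a).
  exact: free_mulgV.
by apply: val_inj; rewrite /= word_invK.
Qed.

HB.instance Definition _ := isGroup.Build free_group
  free_mulA free_mul1g free_mulg1 free_mulVg free_mulgV.

Definition free_gen (x : X) : free_group := exist _ [:: (x, true)] isT.

Definition word_eval (H : groupType) (f : X -> H) w : H :=
  foldr (fun l h => (if l.2 then f l.1 else (f l.1)^-1) * h) 1 w.

Lemma word_eval_cons (H : groupType) (f : X -> H) l w :
  word_eval f (word_cons l w) =
    (if l.2 then f l.1 else (f l.1)^-1) * word_eval f w.
Proof.
case: w => //= l' w; case: eqP => //= ->; case: l => x [] /=.
  by rewrite mulVKg.
by rewrite mulKg.
Qed.

Lemma free_gen_cons l w (r : reduced (l :: w)) :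
  exist _ (l :: w) r =
    (if l.2 then free_gen l.1 else (free_gen l.1)^-1)
    * exist _ w (reduced_behead r) :> free_group.
Proof.
apply: val_inj; case: l r => x b /= r.
have E : word_cons (x, b) w = (x, b) :: w.
  by case: w r => //= l' w /andP[/negPf ->].
by rewrite -{1}E; case: b {E r}.
Qed.

(* The universal property of the free group on [X]. *)
Lemma free_group_universal (H : groupType) (f : X -> H) :
  exists! phi : free_group -> H,
    {morph phi : a b / a * b} /\ forall x, phi (free_gen x) = f x.
Proof.
exists (fun a => word_eval f (val a)); split.
  split=> [a b|x] /=; last by rewrite mulg1.
  elim: (val a) => [|l w IHw] /=; first by rewrite mul1g.
  by rewrite word_eval_cons IHw mulgA.
move=> phi [phiM phi_gen].
have phi1 : phi 1 = 1 by apply: (mulgI (phi 1)); rewrite -phiM !mulg1.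
have phiV a : phi a^-1 = (phi a)^-1.
  by apply: (mulgI (phi a)); rewrite -phiM !mulgV.
have E w (r : reduced w) : word_eval f w = phi (exist _ w r).
  elim: w r => [|l w IHw] r /=.
    by rewrite -phi1; congr phi; apply: val_inj.
  rewrite free_gen_cons phiM -IHw; congr (_ * _).
  by case: (l.2); rewrite ?phiV phi_gen.
by apply/funext => -[w r]; exact: E.
Qed.

End FreeGroup.

(* Main.v *)
Require Import Defs.
From HB Require Import structures.
From mathcomp Require Import all_boot monoid all_order all_algebra complex.
From mathcomp Require Import all_classical reals topology normedtype.
From mathcomp Require Import ring lra zify.

(** Let G be a finitely generated discrete group satisfying Chu duality. The
    inverse of the evaluation map is continuous at the identity, so some
    neighbourhood of the identity in the Chu dual contains no ev(g) with g <> 1.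
    In terms of representations there are a degree k and a radius e > 0 such that
    every g <> 1 is at distance at least e from 1 in some unitary representation
    of degree at most k ([chu_duality_gap]). It remains to show that a finitely
    generated group with such a gap is virtually abelian.

    This is done in the spirit of the proof of Jordan's theorem on finite linear
    groups. Commutators contract near the identity: |[u, v] - 1| is at most a
    constant times |u - 1| |v - 1|. Moreover, by pigeonhole, every unitary u of
    degree at most k has a power u^m near 1 with m bounded in terms of k. Nesting
    sufficiently many commutators with the powers u^m therefore gives a word
    w(u, v) whose values are e-close to 1 for all unitary u, v of degree at most
    k ([almost_law]). On the other hand, if u and v are near 1 and do not
    commute, then w(u, v) is not 1 ([nested_commg_noncomm]). This rests on two
    facts about unitaries near 1: if u commutes with [u, v] then it commutes with
    v ([commute_commg], a trace computation), and if u^m commutes with v then so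
    does u ([commuteX_cancel]).

    Evaluated in G, the word shows that in each representation f of degree at
    most k the elements of G that f maps near 1 commute under f: otherwise
    w(a, h) would be a nontrivial element violating the gap
    ([gap_small_commute]). Their double centraliser is then abelian under f, and
    its index is bounded by the number of cells of a fine partition of U(n),
    uniformly in f. As G is finitely generated, it has finitely many subgroups of
    bounded index, so the intersection of these double centralisers over all f
    has finite index. A commutator of two of its elements is trivial in every f,
    hence trivial by the gap ([gap_virtually_abelian]).

    Finally, a subgroup of finite index in the free group on a, b contains a^m
    and b^n for some m, n > 0, and these do not commute. *)

Set Implicit Arguments.
Unset Strict Implicit.
Unset Printing Implicit Defensive.

Import Order.TTheory GRing.Theory Num.Theory.
Import numFieldNormedType.Exports.

(** * The entrywise l1 norm of complex matrices *)

Local Open Scope ring_scope.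

Section L1Norm.
Variable C : numClosedFieldType.

Definition l1norm m n (A : 'M[C]_(m, n)) : C := \sum_i \sum_j `|A i j|.

Lemma l1norm_ge0 m n (A : 'M[C]_(m, n)) : 0 <= l1norm A.
Proof. by apply: sumr_ge0 => i _; apply: sumr_ge0 => j _; exact: normr_ge0. Qed.

Lemma ler_coord_l1norm m n (A : 'M[C]_(m, n)) i j : `|A i j| <= l1norm A.
Proof.
rewrite /l1norm (bigD1 i) //= (bigD1 j) //= -addrA lerDl addr_ge0 //.
  exact: sumr_ge0.
by apply: sumr_ge0 => i' _; exact: sumr_ge0.
Qed.

Lemma l1norm_le0 m n (A : 'M[C]_(m, n)) : l1norm A <= 0 -> A = 0.
Proof.
move=> A0; apply/matrixP => i j; apply/eqP; rewrite mxE -normr_le0.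
exact: le_trans (ler_coord_l1norm A i j) A0.
Qed.

Lemma l1norm0 m n : l1norm (0 : 'M[C]_(m, n)) = 0.
Proof.
by rewrite /l1norm big1 // => i _; rewrite big1 // => j _; rewrite mxE normr0.
Qed.

Lemma l1normN m n (A : 'M[C]_(m, n)) : l1norm (- A) = l1norm A.
Proof.
by apply: eq_bigr => i _; apply: eq_bigr => j _; rewrite mxE normrN.
Qed.

Lemma l1normD m n (A B : 'M[C]_(m, n)) : l1norm (A + B) <= l1norm A + l1norm B.
Proof.
rewrite /l1norm -big_split; apply: ler_sum => i _.
rewrite -big_split; apply: ler_sum => j _; rewrite mxE; exact: ler_normD.
Qed.

Lemma l1normB m n (A B : 'M[C]_(m, n)) : l1norm (A - B) <= l1norm A + l1norm B.
Proof. by rewrite -(l1normN B); exact: l1normD. Qed.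

Lemma l1norm_sum m n I (r : seq I) (P : pred I) (F : I -> 'M[C]_(m, n)) :
  l1norm (\sum_(i <- r | P i) F i) <= \sum_(i <- r | P i) l1norm (F i).
Proof.
elim/big_rec2: _ => [|i x A _ le_Ax]; first by rewrite l1norm0.
by apply: le_trans (l1normD _ _) _; rewrite lerD2l.
Qed.

Lemma l1normMn m n (A : 'M[C]_(m, n)) p : l1norm (A *+ p) = l1norm A *+ p.
Proof.
rewrite /l1norm -sumrMnl; apply: eq_bigr => i _; rewrite -sumrMnl.
by apply: eq_bigr => j _; rewrite mulmxnE normrMn.
Qed.

Lemma l1normM m n p (A : 'M[C]_(m, n)) (B : 'M[C]_(n, p)) :
  l1norm (A *m B) <= l1norm A * l1norm B.
Proof.
rewrite /l1norm mulr_suml; apply: ler_sum => i _.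
rewrite mulr_suml.
apply: (@le_trans _ _ (\sum_j \sum_k `|A i k| * `|B k j|)).
  apply: ler_sum => j _; rewrite mxE; apply: le_trans (ler_norm_sum _ _ _) _.
  by apply: ler_sum => k _; rewrite normrM.
rewrite exchange_big; apply: ler_sum => k _; rewrite -mulr_sumr.
apply: ler_wpM2l => //; rewrite (bigD1 k) //= lerDl.
by apply: sumr_ge0 => k' _; exact: sumr_ge0.
Qed.

Lemma unitarymx_coord_le1 n (A : 'M[C]_n) i j :
  A \is unitarymx -> `|A i j| <= 1.
Proof.
move=> /unitarymxP/matrixP/(_ i i); rewrite !mxE eqxx mulr1n => Aii.
rewrite -(@expr_le1 _ 2) // -Aii (bigD1 j) //= !mxE -normCK lerDl.
by apply: sumr_ge0 => k _; rewrite !mxE -normCK exprn_ge0.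
Qed.

(** The l1 norm is submultiplicative for trivial reasons but not unitarily
    invariant; this bound replaces the invariance, at the price of constants
    that depend on the degree. *)
Lemma l1norm_unitary n (A : 'M[C]_n) :
  A \is unitarymx -> l1norm A <= (n * n)%:R.
Proof.
move=> uA; apply: (@le_trans _ _ (\sum_(i < n) \sum_(j < n) 1)).
  by apply: ler_sum => i _; apply: ler_sum => j _; exact: unitarymx_coord_le1.
by rewrite !(sumr_const, card_ord) -mulrnA.
Qed.

(** * Two commutation criteria near the identity *)

Local Notation "A ^*t" := (map_mx Num.conj A^T) (at level 8).

Let l2 n (A : 'M[C]_n) : C := \tr (A^*t *m A).

Let l2E n (A : 'M[C]_n) : l2 A = \sum_i \sum_j `|A j i| ^+ 2.
Proof.
rewrite /l2 /mxtrace; apply: eq_bigr => i _; rewrite mxE.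
by apply: eq_bigr => j _; rewrite !mxE mulrC -normCK.
Qed.

(** With |D|_2 the Frobenius norm, the inequality reads
    |tr(D^* E D)| <= |E|_1 |D|_2^2. Each coefficient E j k comes with the inner
    product of the rows j and k of D, which the arithmetic-geometric mean
    inequality bounds by |D|_2^2. *)
Lemma mxtrace_adj_mul_le n (E D : 'M[C]_n) :
  `|\tr (D^*t *m E *m D)| <= l1norm E * \tr (D^*t *m D).
Proof.
rewrite -/(l2 D) {1}/mxtrace.
apply: (@le_trans _ _ (\sum_i \sum_k \sum_j `|E j k| * (`|D j i| * `|D k i|))).
  apply: le_trans (ler_norm_sum _ _ _) _; apply: ler_sum => i _; rewrite mxE.
  apply: le_trans (ler_norm_sum _ _ _) _; apply: ler_sum => k _; rewrite mxE.
  rewrite mulr_suml.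
  apply: le_trans (ler_norm_sum _ _ _) _; apply: ler_sum => j _.
  by rewrite !mxE !normrM norm_conjC mulrAC mulrA [_ * `|E _ _|]mulrC mulrA.
rewrite exchange_big /= /l1norm mulr_suml.
under eq_bigr do rewrite exchange_big /=.
rewrite exchange_big /=; apply: ler_sum => j _; rewrite mulr_suml.
apply: ler_sum => k _; rewrite -mulr_sumr; apply: ler_wpM2l => //.
have row_le i : \sum_l `|D i l| ^+ 2 <= l2 D.
  rewrite l2E exchange_big /= [leRHS](bigD1 i) //= lerDl.
  by apply: sumr_ge0 => ? _; apply: sumr_ge0 => ? _; rewrite exprn_ge0.
rewrite -(@ler_pM2l _ 2) ?ltr0n // mulr_sumr.
apply: (@le_trans _ _ (\sum_i (`|D j i| ^+ 2 + `|D k i| ^+ 2))).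
  apply: ler_sum => i _; rewrite -subr_ge0.
  have -> : `|D j i| ^+ 2 + `|D k i| ^+ 2 - 2 * (`|D j i| * `|D k i|) =
    (`|D j i| - `|D k i|) ^+ 2 by ring.
  by rewrite real_exprn_even_ge0 // rpredB // normr_real.
by rewrite big_split mulr_natl mulr2n lerD.
Qed.

(** Put D = A - A', so that B D = B A - A B. Since D^* commutes with A, cyclicity
    of the trace gives tr(D^* B D) = 0, hence |D|_2^2 = - tr(D^* (B - 1) D),
    which is at most |B - 1|_1 |D|_2^2. Thus D vanishes once |B - 1|_1 < 1. *)
Lemma eq_commuting_conj n (A A' B : 'M[C]_n) :
  A \is unitarymx -> A' \is unitarymx ->
  B *m A' = A *m B -> A *m A' = A' *m A -> l1norm (B - 1%:M) < 1 -> A = A'.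
Proof.
move=> uA uA' BA' cAA' B1; set D := A - A'.
have adjK (U : 'M[C]_n) : U \is unitarymx -> U^*t *m U = 1%:M.
  by move=> /unitarymxP/mulmx1C.
have cAD : A *m D^*t = D^*t *m A.
  rewrite /D linearB /= map_mxB mulmxBr mulmxBl.
  rewrite (unitarymxP uA) (adjK _ uA); congr (_ - _).
  by rewrite -[LHS]mul1mx -(adjK _ uA') -!mulmxA (mulmxA A') -cAA' -mulmxA
    (unitarymxP uA') mulmx1.
have BD : B *m D = B *m A - A *m B by rewrite /D mulmxBr BA'.
have tr0 : \tr (D^*t *m (B *m D)) = 0.
  rewrite BD mulmxBr linearB /= (mulmxA _ A) -cAD -(mulmxA A) (mxtrace_mulC A).
  by rewrite mulmxA subrr.
have := mxtrace_adj_mul_le (B - 1%:M) D.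
rewrite (mulmxBr _ B) mulmx1 (mulmxBl _ _ D) linearB /=.
rewrite -mulmxA tr0 sub0r normrN.
have D0 : 0 <= l2 D.
  rewrite l2E; apply: sumr_ge0 => i _; apply: sumr_ge0 => j _.
  by rewrite exprn_ge0.
rewrite -/(l2 D) ger0_norm // => le_D.
have D_eq0 : l2 D = 0.
  apply/eqP/contraT => Dn0; have D_gt0 : 0 < l2 D by rewrite lt_def Dn0.
  have : l2 D < l2 D by apply: le_lt_trans le_D _; rewrite gtr_pMl.
  by rewrite ltxx.
apply/eqP; rewrite -subr_eq0 -/D; apply/eqP/matrixP => i j; rewrite [RHS]mxE.
move: D_eq0; rewrite l2E => /psumr_eq0P D_eq0.
apply/eqP; rewrite -normr_eq0 -sqrf_eq0; apply/eqP.
have /psumr_eq0P -> // : \sum_k `|D k j| ^+ 2 = 0.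
  by apply: D_eq0 => // k _; apply: sumr_ge0 => l _; rewrite exprn_ge0.
by move=> k _; rewrite exprn_ge0.
Qed.

(** The Leibniz rule for the derivation [_ , Y] applied to A ^+ m. *)
Lemma commutator_expmx n (A D Y : 'M[C]_n) m :
  D = A * Y - Y * A ->
  A ^+ m * Y - Y * A ^+ m = \sum_(i < m) A ^+ i * D * A ^+ (m - i.+1).
Proof.
move=> DE; elim: m => [|m IHm].
  by rewrite big_ord0 !expr0 mul1r mulr1 subrr.
rewrite big_ord_recl expr0 mul1r subn1 /=.
under eq_bigr => i _ do
  rewrite /bump /= add1n subSS exprS -2!mulrA (mulrA (A ^+ i)).
rewrite -mulr_sumr -IHm DE mulrBl mulrBr !exprS !mulrA.
by rewrite [RHS]addrC addrA subrK.
Qed.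

(** Every summand of the Leibniz expansion of [A ^+ m, Y] is close to
    D = [A, Y] because the powers of A are close to 1, so the sum is close to
    m D, and it can vanish only if D does. *)
Lemma comm_expmx_cancel n (A Y : 'M[C]_n) (c s : C) m : (0 < m)%N ->
    (forall i, (i < m)%N -> l1norm (A ^+ i) <= c) ->
    (forall i, (i < m)%N -> l1norm (A ^+ i - 1) <= s) ->
    0 <= s -> (c + 1) * s < 1 ->
  A ^+ m * Y = Y * A ^+ m -> A * Y = Y * A.
Proof.
move=> m_gt0 le_c le_s s0 cs1 AmY; set D := A * Y - Y * A.
have := commutator_expmx m (erefl D); rewrite AmY subrr => sum0.
have DE : A * Y - Y * A = D by [].
clearbody D; have mD : D *+ m = \sum_(i < m) (D - A ^+ i * D * A ^+ (m - i.+1)).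
  by rewrite sumrB -sum0 subr0 sumr_const card_ord.
have : l1norm D *+ m <= ((c + 1) * s * l1norm D) *+ m.
  rewrite -l1normMn mD; apply: le_trans (l1norm_sum _ _ _) _.
  rewrite -[m in leRHS]card_ord -sumr_const; apply: ler_sum => i _.
  set P := A ^+ i; set Q := A ^+ _.
  have -> : D - P * D * Q = - ((P - 1) * D * Q + D * (Q - 1)).
    by rewrite !(mulrBl, mulrBr) mul1r mulr1 addrA subrK opprB.
  rewrite l1normN; apply: le_trans (l1normD _ _) _.
  have lt_m : (m - i.+1 < m)%N by rewrite ltn_subrL m_gt0.
  have -> : (c + 1) * s * l1norm D = s * l1norm D * c + l1norm D * s by ring.
  apply: lerD; apply: le_trans (l1normM _ _) _; apply: ler_pM;
    rewrite ?l1norm_ge0 ?le_s ?le_c //.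
  apply: le_trans (l1normM _ _) _; apply: ler_wpM2r; rewrite ?l1norm_ge0 //.
  exact: le_s.
rewrite lerMn2r eqn0Ngt m_gt0 /= => leD.
apply/eqP; rewrite -subr_eq0 DE; apply/eqP/l1norm_le0.
have : l1norm D <= 0 \/ 0 < l1norm D.
  by move: (l1norm_ge0 D); rewrite le_eqVlt => /orP[/eqP <-|->]; [left|right].
case=> // D_gt0; have : l1norm D < l1norm D.
  by apply: le_lt_trans leD _; rewrite gtr_pMl.
by rewrite ltxx.
Qed.

End L1Norm.

(** * Distance to the identity in U(n) *)

Section UnitaryDistance.
Variables (R : realType) (k : nat).
Local Notation C := (cplx R).
Local Notation U := (unitary R).

Definition dist1 n (u : U n) : C := l1norm (umx u - 1%:M).

Lemma dist1_ge0 n (u : U n) : 0 <= dist1 u.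
Proof. exact: l1norm_ge0. Qed.

Lemma umx1 n : umx (1%g : U n) = 1.
Proof. exact: umx_Unitary. Qed.

Lemma umxMr n (u v : U n) : umx (u * v)%g = umx u * umx v.
Proof. exact: umxM. Qed.

Lemma umxMg n (u v : U n) : umx (u * v)%g = umx u *m umx v.
Proof. exact: umxM. Qed.

Lemma umxX n (u : U n) m : umx (u ^+ m)%g = umx u ^+ m.
Proof. by elim: m => [|m IHm]; rewrite ?umx1 // expgS umxMr IHm exprS. Qed.

Lemma umx_commute n (u v : U n) :
  commute u v <-> umx u * umx v = umx v * umx u.
Proof.
split=> [uv|uv]; first by rewrite -!umxMr uv.
by apply: umx_inj; rewrite !umxMr.
Qed.

Lemma dist1_1 n : dist1 (1%g : U n) = 0.
Proof. by rewrite /dist1 umx1 subrr l1norm0. Qed.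

(** The successor keeps the bound invertible in every degree. Bounding all
    degrees at most k by the same constant makes later estimates uniform over the
    representations of degree at most k. *)
Definition umx_bound : C := (k * k).+1%:R.

Lemma umx_bound_ge1 : 1 <= umx_bound.
Proof. by rewrite ler1n. Qed.

Lemma l1norm_umx n (u : U n) : (n <= k)%N -> l1norm (umx u) <= umx_bound.
Proof.
move=> le_nk; apply: le_trans (l1norm_unitary (umx_unitary u)) _.
by rewrite ler_nat leqW // leq_mul.
Qed.

Lemma dist1_le n (u : U n) : (n <= k)%N -> dist1 u <= 2 * umx_bound.
Proof.
move=> le_nk; apply: le_trans (l1normB _ _) _; rewrite mulr_natl mulr2n.
by apply: lerD; [exact: l1norm_umx|rewrite -[1%:M]umx1; exact: l1norm_umx].
Qed.

(** The commutator contraction that drives the proof: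
    [~ u, v] - 1 = (v u)^-1 ((u - 1) (v - 1) - (v - 1) (u - 1)). *)
Lemma dist1R n (u v : U n) : (n <= k)%N ->
  dist1 [~ u, v]%g <= 2 * umx_bound * dist1 u * dist1 v.
Proof.
move=> le_nk; have -> : [~ u, v]%g = ((v * u)^-1 * (u * v))%g.
  by rewrite invgM -!mulgA.
rewrite /dist1 umxMr.
have -> : umx (v * u)^-1%g * umx (u * v)%g - 1 = umx (v * u)^-1%g *
    ((umx u - 1) * (umx v - 1) - (umx v - 1) * (umx u - 1)).
  rewrite -(umx1 n) -{1}(mulVg (v * u)%g) umxMr -mulrBr umx1; congr (_ * _).
  rewrite !umxMr; set x := umx u; set y := umx v.
  rewrite [RHS](_ : _ = (x - 1) * y - y * (x - 1)).
    by rewrite mulrBl mulrBr mul1r mulr1 opprB addrA subrK.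
  rewrite (mulrBr _ y) [(y - 1) * _]mulrBl mul1r mulr1.
  by rewrite (opprB _ (x - 1)) addrA subrK.
apply: le_trans (l1normM _ _) _.
rewrite -!mulrA [2 * _]mulrCA; apply: ler_pM; rewrite ?l1norm_ge0 ?l1norm_umx //.
apply: le_trans (l1normB _ _) _; rewrite mulr_natl mulr2n; apply: lerD.
  exact: l1normM.
by rewrite mulrC; exact: l1normM.
Qed.

Lemma dist1X n (u : U n) i : (n <= k)%N ->
  dist1 (u ^+ i)%g <= i%:R * (umx_bound * dist1 u).
Proof.
move=> le_nk; elim: i => [|i IHi]; first by rewrite dist1_1 mul0r.
have -> : dist1 (u ^+ i.+1)%g =
    l1norm (umx (u ^+ i)%g * (umx u - 1) + (umx (u ^+ i)%g - 1)).
  by rewrite /dist1 expgSr umxMr mulrBr mulr1 addrA subrK.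
apply: le_trans (l1normD _ _) _; rewrite -natr1 mulrDl mul1r addrC.
apply: lerD => //; apply: le_trans (l1normM _ _) _.
by apply: ler_wpM2r; rewrite ?l1norm_ge0 ?l1norm_umx.
Qed.

(** If u commutes with [~ u, v] it commutes with its conjugate u ^ v, and
    [eq_commuting_conj] then forces u ^ v = u. This is the step of Frobenius'
    proof of Jordan's theorem on finite linear groups. *)
Lemma commute_commg n (u v : U n) :
  dist1 v < 1 -> commute u [~ u, v]%g -> commute u v.
Proof.
move=> v1 cuR; have uv : commute u (u ^ v)%g.
  have -> : (u ^ v = u * [~ u, v])%g by rewrite commgEl mulVKg.
  exact: commuteM (commute_refl u) cuR.
have : umx u = umx (u ^ v)%g.
  apply: (@eq_commuting_conj _ _ _ _ (umx v)) => //; try exact: umx_unitary.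
    by rewrite -!umxMg conjgE mulVKg.
  by rewrite -!umxMg uv.
by move=> /umx_inj/esym/conjg_fixP/commgP.
Qed.

Lemma commuteX_cancel n (u v : U n) m : (n <= k)%N -> (0 < m)%N ->
    (forall i, (i < m)%N -> 4 * umx_bound * dist1 (u ^+ i)%g <= 1) ->
  commute (u ^+ m)%g v -> commute u v.
Proof.
move=> le_nk m_gt0 small_u /umx_commute; rewrite umxX => umv; apply/umx_commute.
have c_gt0 : 0 < umx_bound by apply: lt_le_trans umx_bound_ge1.
apply: (@comm_expmx_cancel _ _ _ _ umx_bound (4 * umx_bound)^-1 m)
  => // [i _|i lt_im||].
- by rewrite -umxX; exact: l1norm_umx.
- rewrite -umxX -[1]/(1%:M) -div1r ler_pdivlMr ?mulr_gt0 // mulrC; exact: small_u.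
- by rewrite invr_ge0 mulr_ge0 // ltW.
rewrite ltr_pdivrMr ?mulr_gt0 // mul1r.
by rewrite /umx_bound natr1 -natrM ltr_nat; lia.
Qed.

End UnitaryDistance.

(** * Nested commutators *)

Definition nested_commg (G : groupType) (a : G) (l : seq nat) (h : G) : G :=
  foldr (fun m y => [~ a ^+ m, y]%g) h l.

Section AlmostLaw.
Variables (R : realType) (k : nat).
Local Notation C := (cplx R).
Local Notation U := (unitary R).
Local Notation c := (umx_bound R k).

Definition exponents_upto N l := all (fun m => 0 < m <= N)%N l.

Let two_gt0 : 0 < 2 * c.
Proof. by rewrite mulr_gt0 // (lt_le_trans _ (umx_bound_ge1 R k)). Qed.

Lemma dist1R_small n (u v : U n) : (n <= k)%N -> 4 * c * dist1 u <= 1 ->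
  2 * dist1 [~ u, v]%g <= dist1 v.
Proof.
move=> le_nk u_small; apply: (@le_trans _ _ (4 * c * dist1 u * dist1 v)).
  have -> : 4 * c * dist1 u * dist1 v = 2 * (2 * c * dist1 u * dist1 v) by ring.
  by rewrite ler_pM2l //; exact: dist1R.
by rewrite ler_piMl ?dist1_ge0.
Qed.

(** Near the identity nested commutators cannot become trivial by accident: if
    u commuted with [~ u ^+ m, y], then so would u ^+ m, hence u ^+ m would
    commute with y by [commute_commg], and u with y by [commuteX_cancel]. *)
Lemma nested_commg_noncomm n (u v : U n) N l : (n <= k)%N ->
    (forall i, (i <= N)%N -> 4 * c * dist1 (u ^+ i)%g <= 1) ->
    exponents_upto N l -> dist1 v < 1 -> ~ commute u v ->
  dist1 (nested_commg u l v) < 1 /\ ~ commute u (nested_commg u l v).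
Proof.
move=> le_nk u_small lN v1 ncuv; elim: l lN => //= m l IHl.
move=> /andP[/andP[m_gt0 le_mN] /IHl[y1 ncuy]]; split.
  apply: le_lt_trans y1; apply: le_trans (dist1R_small _ le_nk (u_small m le_mN)).
  by rewrite ler_peMl ?dist1_ge0 // ler1n.
move=> cuR; apply: ncuy; apply: (commuteX_cancel le_nk m_gt0) => [i lt_im|].
  by apply: u_small; exact: leq_trans (ltnW lt_im) le_mN.
apply: (commute_commg y1); apply: commute_sym.
by apply: commuteX; exact: commute_sym.
Qed.

Lemma dist1_nested_le n (u v : U n) l : (n <= k)%N ->
  dist1 (nested_commg u l v) <= (2 * c * (2 * c)) ^+ size l * dist1 v.
Proof.
move=> le_nk; elim: l => [|m l IHl] /=; first by rewrite expr0 mul1r.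
apply: le_trans (dist1R _ _ le_nk) _; rewrite exprS -[leRHS]mulrA.
apply: ler_pM => //; rewrite ?ler_pM2l ?dist1_le ?dist1_ge0 //.
by rewrite mulr_ge0 ?dist1_ge0 ?ltW.
Qed.

Lemma nested_nseq_small n (u v : U n) m L : (n <= k)%N ->
  4 * c * dist1 (u ^+ m)%g <= 1 ->
  2 ^+ L * dist1 (nested_commg u (nseq L m) v) <= dist1 v.
Proof.
move=> le_nk u_small; elim: L => [|L IHL] /=; first by rewrite expr0 mul1r.
apply: le_trans IHL; rewrite exprSr -mulrA ler_pM2l ?exprn_gt0 //.
exact: dist1R_small.
Qed.

(** The exponent N.+1 is used innermost, and repeated so often that, when
    u ^+ N.+1 is near 1, the gain 2 ^+ K outweighs the loss of the outer
    commutators, whose number is already settled. When another power of u is near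
    1, the outer commutators are small whatever they are applied to. *)
Lemma nested_commg_contracting N q : exists2 l, exponents_upto N l &
  forall n (u v : U n), (n <= k)%N ->
    (exists2 m, (0 < m <= N)%N & 4 * c * dist1 (u ^+ m)%g <= 1) ->
    q%:R * dist1 (nested_commg u l v) <= 1.
Proof.
elim: N => [|N [l lN lP]].
  by exists [::] => // n u v _ [[|m]].
(* K is q times the loss of the outer commutators times the bound 2 c on the
   distance to 1 of the innermost v, and K <= 2 ^ K. *)
pose K :=
  (q * (2 * (k * k).+1 * (2 * (k * k).+1)) ^ size l * (2 * (k * k).+1))%N.
exists (l ++ nseq K N.+1) => [|n u v le_nk [m /andP[m_gt0]]].
  rewrite /exponents_upto all_cat all_nseq leqnn orbT andbT.
  by apply: sub_all lN => m /andP[-> /leqW].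
rewrite leq_eqVlt => u_small; rewrite /nested_commg foldr_cat.
have {u_small}[/eqP m_eq|lt_m] := orP u_small => u_small; last first.
  by apply: lP => //; exists m; rewrite // m_gt0.
rewrite {m m_gt0}m_eq in u_small.
set y := foldr _ _ (nseq _ _).
have y_small : 2 ^+ K * dist1 y <= 2 * c.
  apply: le_trans (dist1_le _ le_nk); exact: nested_nseq_small.
have K_gt0 : 0 < (2 : C) ^+ K by rewrite exprn_gt0.
rewrite -(ler_pM2l K_gt0) mulr1.
apply: (@le_trans _ _
  (2 ^+ K * (q%:R * ((2 * c * (2 * c)) ^+ size l * dist1 y)))).
  by rewrite ler_pM2l //; apply: ler_wpM2l => //; exact: dist1_nested_le.
rewrite 2![2 ^+ K * _]mulrCA.
apply: (@le_trans _ _ K%:R); last by rewrite -natrX ler_nat ltnW // ltn_expl.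
have -> : K%:R = q%:R * ((2 * c * (2 * c)) ^+ size l * (2 * c)) :> C.
  by rewrite /K /umx_bound !natrM natrX !natrM -[LHS]mulrA.
do 2!apply: ler_wpM2l => //.
by rewrite exprn_ge0 // mulr_ge0 // ltW.
Qed.

End AlmostLaw.

(** * Finite partitions of U(n) into small cells, and the almost law *)

Section Labels.
Variable R : realType.
Local Notation C := (cplx R).
Local Notation U := (unitary R).

Definition grid_index (M : nat) (x : R) : nat := Num.trunc (M%:R * (x + 1)).

Lemma grid_index_lt M x : `|x| <= 1 -> (grid_index M x < (2 * M).+1)%N.
Proof.
rewrite ler_norml => /andP[x_ge x_le]; rewrite ltnS /grid_index truncn_le_nat.
apply: (@le_lt_trans _ _ (2 * M)%:R); last by rewrite ltr_nat.
by rewrite natrM mulrC; apply: ler_wpM2r => //; lra.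
Qed.

Lemma grid_index_eq M x y : `|x| <= 1 -> `|y| <= 1 ->
  grid_index M x = grid_index M y -> M%:R * `|x - y| <= 1.
Proof.
rewrite !ler_norml => /andP[x_ge _] /andP[y_ge _] eq_xy.
have x0 : 0 <= M%:R * (x + 1) by rewrite mulr_ge0 //; lra.
have y0 : 0 <= M%:R * (y + 1) by rewrite mulr_ge0 //; lra.
have := truncn_itv x0; have := truncn_itv y0.
rewrite -/(grid_index M x) -/(grid_index M y) eq_xy -natr1.
move=> /andP[y1 y2] /andP[x1 x2].
rewrite -[M%:R]ger0_norm // -normrM ler_norml; apply/andP; split; lra.
Qed.

Lemma norm_ge_Re_Im (z : C) :
  [/\ (`|complex.Re z|)%:C%C <= `|z|, (`|complex.Im z|)%:C%C <= `|z| &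
   `|z| <= (`|complex.Re z| + `|complex.Im z|)%:C%C].
Proof.
rewrite normc_def; case: z => a b /=; rewrite !lecR; split.
- by rewrite -sqrtr_sqr ler_wsqrtr // lerDl sqr_ge0.
- by rewrite -sqrtr_sqr ler_wsqrtr // lerDr sqr_ge0.
rewrite -[leRHS]ger0_norm ?addr_ge0 // -sqrtr_sqr ler_wsqrtr //.
rewrite -(real_normK (num_real a)) -(real_normK (num_real b)).
by have := normr_ge0 a; have := normr_ge0 b; nra.
Qed.

Definition cell (M : nat) (z : C) : nat * nat :=
  (grid_index M (complex.Re z), grid_index M (complex.Im z)).

Lemma norm_ReIm_le1 (z : C) : `|z| <= 1 ->
  `|complex.Re z| <= 1 /\ `|complex.Im z| <= 1.
Proof.
have [re im _] := norm_ge_Re_Im z => z1; rewrite -!lecR.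
by split; [apply: le_trans re z1|apply: le_trans im z1].
Qed.

Lemma cell_eq M (z w : C) : `|z| <= 1 -> `|w| <= 1 ->
  cell M z = cell M w -> M%:R * `|z - w| <= 2.
Proof.
move=> /norm_ReIm_le1[re_z im_z] /norm_ReIm_le1[re_w im_w] [re_eq im_eq].
have [_ _ le_zw] := norm_ge_Re_Im (z - w).
apply: le_trans (ler_wpM2l (ler0n _ M) le_zw) _.
rewrite -[M%:R](rmorph_nat (real_complex R)) -rmorphM.
rewrite -[2](rmorph_nat (real_complex R)) lecR mulrDr.
have := grid_index_eq re_z re_w re_eq; have := grid_index_eq im_z im_w im_eq.
by rewrite !raddfB /=; lra.
Qed.

(** Total boundedness of U(n): the label of u records the cells of its entries in
    a square grid. Labels are indexed by 'I_k * 'I_k, not by pairs of indices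
    below n, so that one finite type serves all the degrees n <= k. *)
Lemma unitary_labelling k q : exists T : finType, forall n, (n <= k)%N ->
  exists label : U n -> T, forall u v,
    label u = label v -> q%:R * dist1 (u * v^-1)%g <= 1.
Proof.
(* The mesh must beat the 2 of [cell_eq], the number n * n of entries, and one
   more factor [umx_bound] for the product with v^-1. *)
pose M := (q * (k * k).+1 * (2 * (k * k).+1))%N.
exists {ffun 'I_k * 'I_k -> 'I_(2 * M).+1 * 'I_(2 * M).+1} => n le_nk.
pose entry (u : U n) (p : 'I_k * 'I_k) :=
  if (insub (p.1 : nat), insub (p.2 : nat)) is (Some i, Some j)
  then cell M (umx u i j) else (0, 0)%N.
exists (fun u => [ffun p => (inord (entry u p).1, inord (entry u p).2)]).
move=> u v /ffunP eq_uv.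
have coord1 (w : U n) i j : `|umx w i j| <= 1.
  exact: unitarymx_coord_le1 (umx_unitary w).
have entry_lt (w : U n) p :
    ((entry w p).1 < (2 * M).+1)%N /\ ((entry w p).2 < (2 * M).+1)%N.
  rewrite /entry; case: insub => // i; case: insub => //= j.
  by have [] := norm_ReIm_le1 (coord1 w i j); split; exact: grid_index_lt.
have cell_uv i j : cell M (umx u i j) = cell M (umx v i j).
  have := eq_uv (widen_ord le_nk i, widen_ord le_nk j); rewrite !ffunE.
  set p := (widen_ord _ i, _) => -[/(congr1 val)/= + /(congr1 val)/=].
  have [u1 u2] := entry_lt u p; have [v1 v2] := entry_lt v p.
  have entryE w : entry w p = cell M (umx w i j).
    by rewrite /entry /= -[nat_of_ord i]/(val i) -[nat_of_ord j]/(val j) !valK.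
  rewrite !inordK // !entryE.
  by case: (cell _ _) (cell _ _) => ? ? [? ?] /= -> ->.
pose c : C := umx_bound R k; have c_gt0 : 0 < c by rewrite ltr0n.
have le_uv : M%:R * l1norm (umx u - umx v) <= 2 * c.
  rewrite /l1norm mulr_sumr.
  apply: (@le_trans _ _ (\sum_(i < n) \sum_(j < n) (2 : C))).
    apply: ler_sum => i _; rewrite mulr_sumr; apply: ler_sum => j _.
    by rewrite !mxE; exact: cell_eq.
  rewrite !(sumr_const, card_ord) -mulrnA -(mulr_natr 2 (n * n)%N).
  rewrite ler_pM2l // ler_nat.
  by rewrite leqW // leq_mul.
have le_dist : dist1 (u * v^-1)%g <= c * l1norm (umx u - umx v).
  have -> : dist1 (u * v^-1)%g = l1norm ((umx u - umx v) *m umx v^-1%g).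
    by rewrite mulmxBl -!umxMg mulgV umx1.
  apply: le_trans (l1normM _ _) _; rewrite mulrC.
  by apply: ler_wpM2r; [exact: l1norm_ge0|exact: l1norm_umx].
rewrite -(@ler_pM2l _ (2 * c)) ?mulr_gt0 // mulr1; apply: le_trans le_uv.
have -> : M%:R = 2 * c * (q%:R * c) :> C.
  by rewrite /M /c /umx_bound !natrM; ring.
by rewrite -[leRHS]mulrA ler_pM2l ?mulr_gt0 // -mulrA ler_wpM2l.
Qed.

(** Two of the powers u ^+ 0, ..., u ^+ #|T| have the same label, and their
    quotient is a power of u near 1. *)
Lemma unitary_power_small k q : exists N, forall n (u : U n), (n <= k)%N ->
  exists2 m, (0 < m <= N)%N & q%:R * dist1 (u ^+ m)%g <= 1.
Proof.
have [T labelP] := unitary_labelling k q; exists #|T|.+1 => // n u le_nk.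
have [label labelE] := labelP n le_nk.
pose f (i : 'I_#|T|.+1) := label (u ^+ i)%g.
have /injectivePn[i [j ne_ij fij]] : ~~ injectiveb f.
  apply/injectiveP => /leq_card; by rewrite card_ord ltnn.
wlog lt_ij : i j ne_ij fij / (i < j)%N => [wl|].
  have := ne_ij; rewrite -val_eqE /= neq_ltn => /orP[|lt_ji]; first exact: wl.
  by apply: (wl j i); rewrite // eq_sym.
exists (j - i)%N.
  by rewrite subn_gt0 lt_ij (leq_trans (leq_subr _ _)) // ltnW.
have -> : (u ^+ (j - i) = u ^+ j * (u ^+ i)^-1)%g.
  by rewrite -[in RHS](subnK (ltnW lt_ij)) expgnDr mulgK.
exact: labelE.
Qed.

(** A single word, nontrivial near the identity by [nested_commg_noncomm], whose
    values on all unitary groups of degree at most k are uniformly close to 1. *)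
Lemma almost_law k q : exists N, exists2 l, exponents_upto N l &
  forall n (u v : U n), (n <= k)%N -> q%:R * dist1 (nested_commg u l v) <= 1.
Proof.
have [N powP] := unitary_power_small k (4 * (k * k).+1).
have [l lN lP] := nested_commg_contracting R k N q.
exists N; exists l => // n u v le_nk; apply: lP => //.
by have [m mN um] := powP n u le_nk; exists m; rewrite // -natrM.
Qed.

End Labels.

(** * Intersecting subgroups of bounded index in a finitely generated group *)

Section FiniteIndex.
Local Open Scope group_scope.
Local Open Scope classical_set_scope.
Variables (G : groupType) (I : Type) (T : finType) (Z : I -> {pred G}).
Variable label : I -> G -> T.
Hypothesis Zgroup : forall i, group_closed (Z i).
Hypothesis labelP : forall i x y, label i x = label i y -> x * y^-1 \in Z i.

(** Labels need not be constant on the cosets of Z i: they are evaluated at a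
    representative, so that [coset_label i] separates exactly the cosets. *)
Let coset_repr i x := xget 1 [set y | y * x^-1 \in Z i].
Let coset_label i x := label i (coset_repr i x).

Let coset_reprP i x : coset_repr i x * x^-1 \in Z i.
Proof.
apply: (@xgetPex _ 1 [set y | y * x^-1 \in Z i]).
by exists x; rewrite /= mulgV; case: (Zgroup i).
Qed.

Lemma coset_labelP i x y :
  coset_label i x = coset_label i y <-> x * y^-1 \in Z i.
Proof.
have [ZM ZV] := (group_closedM (Zgroup i), group_closedV (Zgroup i)).
split=> [/labelP xy|xy]; last first.
  congr (label i (xget 1 _)); apply/seteqP; split=> z /= zP.
    by rewrite -(mulgVK x z) -mulgA; exact: ZM.
  rewrite -(mulgVK y z) -mulgA; apply: ZM => //.
  by rewrite -invgF; exact: ZV.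
have := ZM _ _ (ZM _ _ (ZV _ (coset_reprP i x)) xy) (coset_reprP i y).
by rewrite invgM invgK !mulgA !mulgVK.
Qed.

(** Right translation permutes the right cosets of Z i, so the label of the
    coset of x * g depends only on that of x and on g. *)
Let step i t g := coset_label i (xget 1 [set x | coset_label i x = t] * g).

Let stepE i x g   : step i (coset_label i x) g = coset_label i (x * g).
Proof.
have := @xgetPex _ 1 [set y | coset_label i y = coset_label i x].
move=> /(_ (ex_intro _ x erefl)) /coset_labelP h.
by apply/coset_labelP; rewrite invgM mulgA mulgK.
Qed.

(** A finitely generated group has finitely many subgroups of bounded index: the
    coset labels of i are determined by the label of 1 and by the action of the
    generators and their inverses on T, which leaves finitely many possibilities
    for [coset_label i]. The map Phi collects the values at x of all of them. *)
Lemma finite_index_bigcap : finitely_generated G ->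
  exists (T' : finType) (Phi : G -> T'),
    forall x y, Phi x = Phi y -> forall i, x * y^-1 \in Z i.
Proof.
move=> [s sP].
pose letter (p : 'I_(size s) * bool) : G :=
  if p.2 then nth 1 s p.1 else (nth 1 s p.1)^-1.
pose data i : T * {ffun ('I_(size s) * bool) * T -> T} :=
  (coset_label i 1, [ffun p => step i p.2 (letter p.1)]).
have data_label i j : data i = data j -> coset_label i =1 coset_label j.
  move=> -[eq1 /ffunP eq_move] g.
  pose H : {pred G} := [pred g | `[< forall x,
    coset_label i x = coset_label j x ->
    coset_label i (x * g) = coset_label j (x * g) /\
    coset_label i (x * g^-1) = coset_label j (x * g^-1) >]].
  have Hg : g \in H; last by have /asboolP/(_ _ eq1)[] := Hg; rewrite mul1g.
  apply: sP.
    split=> [|a b /asboolP Ha /asboolP Hb]; apply/asboolP => x eq_x.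
      by rewrite invg1 mulg1.
    rewrite invgF !mulgA; split.
      by have [/Hb[]] := Ha x eq_x.
    by have [/Ha[]] := Hb x eq_x.
  move=> a sa; apply/asboolP => x eq_x.
  have lt_a : (index a s < size s)%N by rewrite index_mem.
  have := eq_move ((Ordinal lt_a, true), coset_label i x).
  have := eq_move ((Ordinal lt_a, false), coset_label i x).
  by rewrite !ffunE /letter /= nth_index // !stepE eq_x !stepE.
(* [None] stands for data that no index realises. *)
exists {ffun T * {ffun ('I_(size s) * bool) * T -> T} -> option T}.
exists (fun g => [ffun t => if pselect (exists i, data i = t) is left h
  then Some (coset_label (sval (cid h)) g) else None]).
move=> x y /ffunP eq_xy i; apply/coset_labelP.
have := eq_xy (data i); rewrite !ffunE; case: pselect => [h|[]]; last by exists i.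
by case: (cid h) => j /= /data_label ji [] ; rewrite !ji.
Qed.

End FiniteIndex.

(** Phi separates right cosets, whereas virtual abelianity is stated with left
    cosets; inversion exchanges the two. *)
Lemma virtually_abelian_of_labelling (G : groupType) (K : {pred G}) (T : finType)
    (Phi : G -> T) :
  group_closed K -> {in K &, forall x y, commute x y} ->
  (forall x y, Phi x = Phi y -> (x * y^-1)%g \in K) -> virtually_abelian G.
Proof.
move=> Kgroup Kab PhiP; exists K; split=> //.
pose coset (x : G) := [set (x * h)%g | h in [set` K]]%classic.
have cosetE x y : Phi x^-1%g = Phi y^-1%g -> coset x = coset y.
  suff sub a b : (a^-1 * b)%g \in K -> (coset a `<=` coset b)%classic.
    move=> /PhiP; rewrite invgK => xyK.
    have yxK : (y^-1 * x)%g \in K.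
      by rewrite -[X in (_ * X)%g]invgK -invgM; exact: group_closedV.
    by apply/seteqP; split; exact: sub.
  move=> abK _ [h hK <-]; exists (b^-1 * a * h)%g => /=; last first.
    by rewrite !mulgA mulgV mul1g.
  apply: (group_closedM Kgroup) => //.
  by rewrite -[X in (_ * X)%g]invgK -invgM; exact: group_closedV.
pose repr t := xget 1%g [set x : G | Phi x^-1%g = t]%classic.
apply: (@sub_finite_set _ _ [set coset (repr t) | t in [set: T]])%classic.
  move=> _ [x _ <-]; exists (Phi x^-1%g) => //; apply: cosetE.
  exact: (@xgetPex _ 1%g [set y : G | Phi y^-1%g = Phi x^-1%g]%classic
            (ex_intro _ x erefl)).
exact/finite_image/finite_finset.
Qed.

(** * Groups kept away from the identity by representations of bounded degree *)

Section Gap.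
Variables (R : realType) (k q : nat) (G : groupType) (I : Type) (d : I -> nat).
Variable f : forall i, UMagmaMorphism.type G (unitary R (d i)).
Hypothesis le_dk : forall i, (d i <= k)%N.
Hypothesis gap : forall g, (forall i, q%:R * dist1 (f i g) <= 1) -> g = 1%g.

Lemma gmulf_nested_commg i a l h :
  f i (nested_commg a l h) = nested_commg (f i a) l (f i h).
Proof. by elim: l => //= m l IHl; rewrite gmulfR gmulfXn IHl. Qed.

(** If a and h were small and did not commute in f i, the almost law evaluated at
    (a, h) would be an element of G that is nontrivial, as f i shows, and yet
    uniformly close to 1, against the gap. *)
Lemma gap_small_commute : exists p, forall i a h,
  p%:R * dist1 (f i a) <= 1 -> p%:R * dist1 (f i h) <= 1 ->
  commute (f i a) (f i h).
Proof.
have [N [l lN lP]] := almost_law R k q.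
have c_gt0 : 0 < umx_bound R k by rewrite ltr0n.
(* The first summand makes all the powers a ^+ j with j <= N small, the second
   puts h at distance less than 1. *)
exists (4 * (k * k).+1 * (N * (k * k).+1) + 2)%N => i a h.
rewrite natrD !(mulrDl _ 2%:R) => a_small h_small; apply/not_notP => ncah.
have dist_ge0 x : 0 <= dist1 (f i x) by exact: dist1_ge0.
have a_pow j : (j <= N)%N -> 4 * umx_bound R k * dist1 (f i a ^+ j)%g <= 1.
  move=> le_jN; apply: le_trans a_small.
  apply: ler_wpDr; first by rewrite mulr_ge0.
  rewrite !natrM -[leRHS]mulrA; apply: ler_wpM2l.
    by rewrite mulr_ge0 // ltW.
  apply: le_trans (dist1X _ _ (le_dk i)) _; rewrite mulrA.
  by apply: ler_wpM2r => //; apply: ler_wpM2r; [exact: ltW|rewrite ler_nat].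
have h1 : dist1 (f i h) < 1.
  have : 2 * dist1 (f i h) <= 1.
    by apply: le_trans h_small; rewrite lerDr mulr_ge0.
  rewrite mulrC -ler_pdivlMr // div1r => /le_lt_trans; apply.
  by rewrite invf_lt1 ?ltr1n.
have [_] := nested_commg_noncomm (le_dk i) a_pow lN h1 ncah; apply.
rewrite -gmulf_nested_commg (@gap (nested_commg a l h)) => [|j]; last first.
  by rewrite gmulf_nested_commg; exact: lP.
by rewrite gmulf1; exact: commute1.
Qed.

(** For each i let Z i be the preimage of the double centraliser of the small
    elements of f i. These commute, so the double centraliser is abelian; it
    contains them, so by pigeonhole Z i has index bounded independently of i.
    The intersection of all Z i has finite index, and it is abelian because its
    commutators are killed by every f i. *)
Theorem gap_virtually_abelian : finitely_generated G -> virtually_abelian G.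
Proof.
move=> Gfg; have [p smallC] := gap_small_commute.
pose small i a : Prop := p%:R * dist1 (f i a) <= 1.
pose cent i h : Prop := forall a, small i a -> commute (f i h) (f i a).
pose Z i : {pred G} :=
  [pred g | `[< forall h, cent i h -> commute (f i g) (f i h) >]].
have small_Z i a : small i a -> a \in Z i.
  by move=> sa; apply/asboolP => h hc; apply: commute_sym; exact: hc.
have Z_group i : group_closed (Z i).
  split=> [|x y /asboolP xZ /asboolP yZ]; apply/asboolP => h hc.
    by rewrite gmulf1; apply: commute_sym; exact: commute1.
  rewrite gmulfF; apply: commute_sym; apply: commuteM.
    exact/commute_sym/xZ.
  by apply: commuteV; exact/commute_sym/yZ.
have Z_abelian i x y : x \in Z i -> y \in Z i -> commute (f i x) (f i y).
  move=> /asboolP xZ /asboolP yZ; apply: xZ => a sa; apply: yZ => b sb.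
  exact: smallC.
have [T labelT] := unitary_labelling R k p.
pose label i := sval (cid (labelT _ (le_dk i))).
have labelP i := svalP (cid (labelT _ (le_dk i))).
have [T' [Phi PhiP]] : exists (T' : finType) (Phi : G -> T'),
    forall x y, Phi x = Phi y -> forall i, (x * y^-1)%g \in Z i.
  apply: (@finite_index_bigcap _ _ T Z (fun i x => label i (f i x))) => // i x y.
  by move=> /labelP; rewrite -gmulfF; exact: small_Z.
apply: (@virtually_abelian_of_labelling _
  [pred x | `[< forall i, x \in Z i >]] T' Phi).
- split=> [|x y /asboolP xZ /asboolP yZ]; apply/asboolP => i.
    by case: (Z_group i).
  by case: (Z_group i) => _; apply.
- move=> x y /asboolP xZ /asboolP yZ; apply/commgP/eqP/gap => i.
  rewrite gmulfR; have /commgP/eqP -> := Z_abelian i x y (xZ i) (yZ i).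
  by rewrite dist1_1 mulr0.
by move=> x y /PhiP xyZ; apply/asboolP.
Qed.

End Gap.

(** * Convergence to the identity in the Chu dual *)

Local Open Scope classical_set_scope.

Section Topology.
Variable R : realType.
Local Notation C := (cplx R).
Local Notation U := (unitary R).

(** The order of the complex numbers is partial, so the real archimedean property
    does not apply directly. *)
Lemma cplx_archimedean (e : C) : 0 < e -> exists m, forall n x,
  (m <= n)%N -> n.+1%:R * x <= 1 -> x < e.
Proof.
rewrite ltcE /= => /andP[/eqP Im0 Re_gt0].
have eE : e = (complex.Re e)%:C%C by case: (e) Im0 => a b /= ->.
exists (Num.trunc (complex.Re e)^-1) => n x le_mn le1.
have n_gt : (complex.Re e)^-1 < n.+1%:R.
  by apply: lt_le_trans (truncnS_gt _) _; rewrite ler_nat.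
have : 1 < n.+1%:R * e.
  rewrite {1}eE -[n.+1%:R](rmorph_nat (real_complex R)) -rmorphM.
  rewrite -[1](rmorph1 (real_complex R)) ltcR.
  by rewrite -ltr_pdivrMr // div1r.
by move=> /(le_lt_trans le1); rewrite ltr_pM2l // ltr0n.
Qed.

Lemma nbhs_set_type (T : topologicalType) (A : set T) (x : set_type A)
    (V : set (set_type A)) : nbhs x V ->
  exists2 O : set T, open O /\ O (set_val x) &
    forall y : set_type A, O (set_val y) -> V y.
Proof.
rewrite nbhsE => -[_ [[O oO <-] Ox] sub]; exists O => //.
Qed.

Lemma nbhs_unitary1 n (V : set (U n)) : nbhs (1%g : U n) V ->
  exists m, forall p u, (m <= p)%N -> p.+1%:R * dist1 u <= 1 -> V u.
Proof.
move=> /nbhs_set_type[O [oO O1] sub].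
have {oO O1} : nbhs (umx (1%g : U n)) O by exact: open_nbhs_nbhs.
case=> P P1 subP.
have [m mP] : exists m, forall i j p, (m <= p)%N -> forall z,
    p.+1%:R * `|z - umx (1%g : U n) i j| <= 1 -> P i j z.
  have : \forall m \near \oo, forall i j p, (m <= p)%N -> forall z,
      p.+1%:R * `|z - umx (1%g : U n) i j| <= 1 -> P i j z.
    apply: filter_forall => i; apply: filter_forall => j.
    have /nbhs_ballP[e /= /cplx_archimedean[m mP] eP] := P1 i j.
    exists m => // m' /= le_mm' p le_p z small; apply: eP.
    rewrite -ball_normE /= distrC; apply: mP small; exact: leq_trans le_p.
  by move=> /filter_ex.
exists m => p u le_mp u_small; apply: sub; apply: subP => i j.
apply: (mP i j p) => //; apply: le_trans u_small; apply: ler_wpM2l => //.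
have := ler_coord_l1norm (umx u - 1%:M) i j.
by rewrite umx1 !mxE.
Qed.

Variable G : groupType.
Local Notation DG := (discrete_topology G).

(** As n grows, these sets generate a filter on G: convergence to 1 uniformly over
    all representations of bounded degree. *)
Definition uniformly_near1 (n : nat) : set DG := [set g |
  forall x : reps R DG, (projT1 x <= n)%N -> n.+1%:R * dist1 (projT2 x g) <= 1].

Lemma uniformly_near1_sub n m :
  (n <= m)%N -> uniformly_near1 m `<=` uniformly_near1 n.
Proof.
move=> le_nm g gm x x_n; apply: le_trans (gm x (leq_trans x_n le_nm)).
by apply: ler_wpM2r; [exact: dist1_ge0|rewrite ler_nat].
Qed.

Lemma rep1 n (phi : rep R DG n) : phi (1%g : G) = 1%g.
Proof. by apply: (mulgI (phi (1%g : G))); rewrite -repM !mulg1. Qed.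

(** Representations of one degree form an open subset of the coproduct, so a
    compact set of representations meets only finitely many degrees; on each of
    them an open set of unitaries that contains 1 contains a ball around 1. The
    near-covering form of compactness makes the radius and the degree uniform. *)
Lemma uniformly_near1_cvg :
  (@evaluation R DG) @ filter_from setT uniformly_near1 -->
    (@evaluation R DG (1%g : G)).
Proof.
have FF : Filter (filter_from setT uniformly_near1).
  apply: filter_from_filter => [|n m _ _]; first by exists 0%N.
  exists (maxn n m) => // g gE.
  by split; apply: uniformly_near1_sub gE; rewrite ?leq_maxl ?leq_maxr.
apply/compact_open_cvgP => K O /compact_near_coveringP cK oO KO.
have : \forall n \near \oo, K `<=`
    [set x | forall g, uniformly_near1 n g -> O (@evaluation R DG g x)].
  apply: cK => -[d phi] Kx.
  have : nbhs (1%g : U d) [set v | O (existT _ d v)].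
    apply: open_nbhs_nbhs; split; first by move/sigT_openP: oO; apply.
    by apply: KO; exists (existT _ d phi) => //=; rewrite /evaluation /= rep1.
  move=> /nbhs_unitary1[m mP].
  exists ([set existT (fun d : degree => rep R DG d) d psi | psi in setT],
          [set n | maxn m d <= n]%N).
    split=> /=; first by apply: existT_nbhs; exact: filterT.
    by exists (maxn m d).
  move=> [_ n] /= [[psi _ <-]]; rewrite geq_max => /andP[le_mn le_dn] g gn.
  by apply: (mP n) => //; exact: (gn (existT _ d psi)).
move=> /filter_ex[n nP]; exists n => // g gn _ [x Kx <-].
exact: nP gn.
Qed.

(** Under duality the topology that G inherits from its Chu dual is discrete, so
    no nontrivial element is close to 1 in all representations of bounded
    degree. *)
Lemma chu_duality_gap : chu_duality R DG ->
  exists n, forall g, uniformly_near1 n g -> g = 1%g.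
Proof.
move=> [_ [inv cinv [evK _]]].
have : nbhs (@ev R DG (1%g : G)) (inv @^-1` [set (1%g : G)]).
  apply: cinv; rewrite evK; exact: (@discrete_set1 DG).
move=> /nbhs_set_type[O [oO O1] sub].
have [n _ nP] : (@evaluation R DG @ filter_from setT uniformly_near1) O.
  by apply: uniformly_near1_cvg; exact: open_nbhs_nbhs.
exists n => g /nP gO; rewrite -(evK g); apply: sub; exact: gO.
Qed.

End Topology.

Section Rep.
Variables (R : realType) (G : groupType) (n : nat).
Variable phi : rep R (discrete_topology G) n.
(** The underlying function, typed so as to carry the morphism structure. *)
Definition rep_morphism : G -> unitary R n := phi.
HB.instance Definition _ :=
  isMultiplicative.Build G (unitary R n) rep_morphism (repM phi).
HB.instance Definition _ :=
  Multiplicative_isUMagmaMorphism.Build G (unitary R n) rep_morphism (rep1 phi).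
End Rep.

Theorem chu_duality_virtually_abelian (R : realType) (G : groupType) :
  finitely_generated G -> chu_duality R (discrete_topology G) ->
  virtually_abelian G.
Proof.
move=> Gfg /chu_duality_gap[k gap].
pose I := {x : reps R (discrete_topology G) | (projT1 x <= k)%N}.
apply: (@gap_virtually_abelian R k k.+1 G I (fun i => projT1 (sval i))
  (fun i => rep_morphism (projT2 (sval i)))) => //.
  by move=> i; exact: svalP i.
by move=> g gP; apply: gap => x x_k; exact: (gP (exist _ x x_k)).
Qed.

(** * The free group on two generators *)

Section Free.
Local Open Scope group_scope.

Lemma free_group_bool_finitely_generated : finitely_generated (free_group bool).
Proof.
exists [:: free_gen true; free_gen false] => H Hgroup gensH [w rw].
have HM := group_closedM Hgroup; have HV := group_closedV Hgroup.
have gen b : free_gen b \in H by apply: gensH; case: b; rewrite !inE eqxx ?orbT.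
elim: w rw => [|l w IHw] rw.
  have -> : exist _ [::] rw = (1 : free_group bool) by exact: val_inj.
  by case: Hgroup.
rewrite free_gen_cons; apply: HM (IHw _).
by case: l.2; [exact: gen|exact: HV].
Qed.

Lemma val_free_genX (X : choiceType) (x : X) n :
  val (free_gen x ^+ n) = nseq n (x, true).
Proof.
elim: n => // n IHn; rewrite expgS /= IHn.
by case: n {IHn} => //= n; rewrite xpair_eqE andbF.
Qed.

Lemma val_free_genXM (X : choiceType) (x y : X) m n :
  val (free_gen x ^+ m * free_gen y ^+ n) = nseq m (x, true) ++ nseq n (y, true).
Proof.
rewrite /= !val_free_genX /word_mul.
elim: m => //= m ->; case: m => [|m] /=; last by rewrite xpair_eqE andbF.
by case: n => //= n; rewrite xpair_eqE andbF.
Qed.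

(** Two of the cosets of the powers of a coincide. *)
Lemma finite_index_expg (G : groupType) (H : {pred G}) (a : G) :
    group_closed H ->
    finite_set [set [set x * h | h in [set` H]] | x in [set: G]]%classic ->
  exists n, a ^+ n.+1 \in H.
Proof.
move=> Hgroup Hfin; have [H1 _] := Hgroup.
pose coset n := [set a ^+ n * h | h in [set` H]]%classic.
have [i [j [lt_ij cij]]] : exists i j, (i < j)%N /\ coset i = coset j.
  apply/not_notP => ninj; apply: infinite_nat.
  apply: (sub_finite_set _ (finite_preimage _ Hfin)) => [i _|i j _ _].
    by exists (a ^+ i).
  rewrite -/(coset i) -/(coset j) => eq_ij.
  case: (ltngtP i j) => // lt_ij; case: ninj; first by exists i, j.
  by exists j, i.
exists (j - i).-1; rewrite prednK ?subn_gt0 //.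
have [h hH] : coset i (a ^+ j) by rewrite cij; exists 1; rewrite ?mulg1.
by rewrite -{1}(subnKC (ltnW lt_ij)) expgnDr => /mulgI <-.
Qed.

Lemma free_group_bool_not_virtually_abelian :
  ~ virtually_abelian (free_group bool).
Proof.
move=> [H [Hgroup Hab Hfin]].
have [m am] := finite_index_expg (free_gen true) Hgroup Hfin.
have [n bn] := finite_index_expg (free_gen false) Hgroup Hfin.
have /(congr1 val) := Hab _ _ am bn.
by rewrite !val_free_genXM.
Qed.
End Free.

Theorem corollary4p1 (R : realType) :
  (forall G : groupType,
     finitely_generated G ->
     chu_duality R (discrete_topology G) ->
     virtually_abelian G) /\
  ~ chu_duality R (discrete_topology (free_group bool)).
Proof.
split=> [G|dual]; first exact: chu_duality_virtually_abelian.
apply: free_group_bool_not_virtually_abelian.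
apply: (chu_duality_virtually_abelian _ dual).
exact: free_group_bool_finitely_generated.
Qed.
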